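(* For any $n \in \mathbb{N}$, the weak order $\preccurlyeq$ restricted to the set of all posets (partial orders) on $[n] = \{1, \dots, n\}$ is a lattice.
   Context: A poset on $[n]$ is a reflexive, transitive, antisymmetric binary relation $R \subseteq [n]^2$. For a reflexive binary relation $R \subseteq [n]^2$, let $R^{\mathsf{Inc}} = \{(a,b) \in R : a \le b\}$ and $R^{\mathsf{Dec}} = \{(b,a) \in R : a \le b\}$, where $\le$ is the natural order on integers. The weak order on reflexive binary relations on $[n]$ is defined by $R \preccurlyeq S$ if and only if $R^{\mathsf{Inc}} \supseteq S^{\mathsf{Inc}}$ and $R^{\mathsf{Dec}} \subseteq S^{\mathsf{Dec}}$. *)

(* Defs.v *)
From mathcomp Require Import all_boot.
Set Implicit Arguments.
Unset Strict Implicit.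
Unset Printing Implicit Defensive.

(* [n] = {1, ..., n} is represented by 'I_n = {0, ..., n - 1}, with the natural
   order of the underlying integers (k stands for k + 1). *)
Definition relation_on (n : nat) := {set 'I_n * 'I_n}.

Definition is_poset (n : nat) (R : relation_on n) : bool :=
  [&& [forall a, (a, a) \in R],
      [forall a, forall b, forall c,
         ((a, b) \in R) && ((b, c) \in R) ==> ((a, c) \in R)]
    & [forall a, forall b, ((a, b) \in R) && ((b, a) \in R) ==> (a == b)]].

Definition poset_on (n : nat) := {R : relation_on n | is_poset R}.

Definition Inc (n : nat) (R : relation_on n) : relation_on n :=
  [set p in R | p.1 <= p.2].

Definition Dec (n : nat) (R : relation_on n) : relation_on n :=
  [set p in R | p.2 <= p.1].

Definition weak_order (n : nat) : rel (relation_on n) :=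
  fun R S => (Inc S \subset Inc R) && (Dec R \subset Dec S).

Definition poset_weak_order (n : nat) : rel (poset_on n) :=
  fun R S => weak_order (val R) (val S).

Definition is_meet (T : Type) (le : rel T) (x y m : T) : Prop :=
  [/\ le m x, le m y & forall z, le z x -> le z y -> le z m].

Definition is_join (T : Type) (le : rel T) (x y j : T) : Prop :=
  [/\ le x j, le y j & forall z, le x z -> le y z -> le j z].

Definition is_lattice (T : Type) (le : rel T) : Prop :=
  [/\ reflexive le, antisymmetric le, transitive le,
      forall x y, exists m, is_meet le x y m
    & forall x y, exists j, is_join le x y j].

(* Main.v *)
Require Import Defs.
From mathcomp Require Import all_boot.

(** Let [I] be the reflexive transitive closure of [Inc R :|: Inc S], and let
    [W] be the union of [I] and [Dec R :&: Dec S]. The meet of two posets [R]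
    and [S] consists of the pairs [(u, v)] such that [i I u] and [v I j] imply
    [(i, j) \in W]. It contains [I], is contained in [W], and is stable under
    composition with [I] on both sides, which gives transitivity. Joins follow
    from meets, because transposition of relations reverses the weak order. *)

Set Implicit Arguments.
Unset Strict Implicit.
Unset Printing Implicit Defensive.

(** * Induction along paths, from either end *)

Section ConnectInduction.

Variables (T : finType) (e : rel T).

(** The first step is peeled off with the endpoint [y] fixed. The connection from [z] to [y] stays
    available, because later steps compose it with other pairs. *)
Lemma connect_ind_left (P : T -> Prop) (y : T) :
    P y -> (forall x z, e x z -> connect e z y -> P z -> P x) ->
  forall x, connect e x y -> P x.
Proof.
move=> Py IH x /connectP[p]; elim: p x => [|z p IHp] x /= => [_ <- //|].
case/andP=> exz pzp ey; apply: (IH x z exz); last exact: IHp.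
by apply/connectP; exists p.
Qed.

Lemma connect_ind_right (P : T -> Prop) (x : T) :
    P x -> (forall z y, connect e x z -> e z y -> P z -> P y) ->
  forall y, connect e x y -> P y.
Proof.
move=> Px IH y /connectP[p]; elim/last_ind: p y => [|p z IHp] y => [_ -> //|].
rewrite rcons_path last_rcons => /andP[pxp epz] ->.
by apply: (IH _ z _ epz); [apply/connectP; exists p | exact: IHp].
Qed.

End ConnectInduction.

Section Posets.

Variable n : nat.
Implicit Types (R S Z : relation_on n) (a b c i j u v : 'I_n).

(** * Posets and the order axioms of the weak order *)

Lemma is_posetP R :
  reflect [/\ forall a, (a, a) \in R,
              forall b a c, (a, b) \in R -> (b, c) \in R -> (a, c) \in R
            & forall a b, (a, b) \in R -> (b, a) \in R -> a = b]
          (is_poset R).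
Proof.
apply: (iffP and3P) => [[/forallP rR /forallP tR /forallP sR]|[rR tR sR]].
  split=> // [b a c ab bc|a b ab ba].
    by have /forallP/(_ b)/forallP/(_ c) := tR a; rewrite ab bc.
  by have /forallP/(_ b) := sR a; rewrite ab ba => /eqP.
split; first exact/forallP.
  apply/forallP=> a; apply/forallP=> b; apply/forallP=> c.
  by apply/implyP=> /andP[]; apply: tR.
apply/forallP=> a; apply/forallP=> b.
by apply/implyP=> /andP[ab ba]; apply/eqP; apply: sR.
Qed.

Lemma weak_orderP R S :
  reflect ((forall a b, a <= b -> (a, b) \in S -> (a, b) \in R) /\
           (forall a b, b <= a -> (a, b) \in R -> (a, b) \in S))
          (weak_order R S).
Proof.
apply: (iffP andP) => [[/subsetP sI /subsetP sD]|[sI sD]].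
  split=> a b ab abS; [have := sI (a, b) | have := sD (a, b)].
    by rewrite !inE /= abS ab => /(_ isT)/andP[].
  by rewrite !inE /= abS ab => /(_ isT)/andP[].
by split; apply/subsetP=> -[a b]; rewrite !inE /= => /andP[abS ab];
  rewrite ab andbT; auto.
Qed.

Lemma weak_order_refl : reflexive (@weak_order n).
Proof. by move=> R; apply/weak_orderP; split. Qed.

Lemma weak_order_anti : antisymmetric (@weak_order n).
Proof.
move=> R S /andP[/weak_orderP[RSi RSd] /weak_orderP[SRi SRd]].
apply/setP=> -[a b]; apply/idP/idP; case/orP: (leq_total a b); auto.
Qed.

Lemma weak_order_trans : transitive (@weak_order n).
Proof.
move=> S R Z /weak_orderP[RSi RSd] /weak_orderP[SZi SZd].
by apply/weak_orderP; split=> a b; auto.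
Qed.

(** * Construction of the meet, as a poset below [R] and [S] *)

Section Meet.

Variables R S : relation_on n.
Hypotheses (posetR : is_poset R) (posetS : is_poset S).

Definition inc_step : rel 'I_n :=
  fun a b => (a <= b) && (((a, b) \in R) || ((a, b) \in S)).

Definition inc_closure : rel 'I_n := connect inc_step.

(** Increasing pairs compose, and so do decreasing ones, but composing an increasing pair with a
    decreasing one may leave this relation. *)
Definition weak_pair : rel 'I_n :=
  fun a b => inc_closure a b ||
             [&& b <= a, (a, b) \in R & (a, b) \in S].

(** This is the largest subrelation of [weak_pair] that is stable under composition with
    [inc_closure] on both sides. Only decreasing pairs are dropped. *)
Definition poset_meet : relation_on n :=
  [set p | [forall i, forall j,
     inc_closure i p.1 && inc_closure p.2 j ==> weak_pair i j]].

Lemma inc_closure_leq a b : inc_closure a b -> a <= b.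
Proof.
move: a; apply: connect_ind_left => // a c /andP[ac _] _.
exact: leq_trans.
Qed.

Lemma poset_meetP u v :
  reflect (forall i j, inc_closure i u -> inc_closure v j -> weak_pair i j)
          ((u, v) \in poset_meet).
Proof.
rewrite inE /=; apply: (iffP forallP) => [h i j iu vj|h i].
  by have /forallP/(_ j) := h i; rewrite iu vj.
by apply/forallP=> j; apply/implyP=> /andP[]; apply: h.
Qed.

Lemma poset_meet_weak_pair u v : (u, v) \in poset_meet -> weak_pair u v.
Proof. by move/poset_meetP; apply; apply: connect0. Qed.

Lemma inc_closure_poset_meet u v : inc_closure u v -> (u, v) \in poset_meet.
Proof.
move=> uv; apply/poset_meetP=> i j iu vj.
by rewrite /weak_pair /inc_closure (connect_trans iu (connect_trans uv vj)).
Qed.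

Lemma poset_meet_comp i u v j :
  inc_closure i u -> (u, v) \in poset_meet -> inc_closure v j ->
  (i, j) \in poset_meet.
Proof.
move=> iu /poset_meetP uv vj; apply/poset_meetP=> i' j' ii' jj'.
by apply: uv; [apply: connect_trans ii' iu | apply: connect_trans vj jj'].
Qed.

(** After extension by [i] and [j], a half that lies in [inc_closure] is absorbed by the other half.
    Otherwise both halves are decreasing pairs of [R] and [S], and these compose. *)
Lemma poset_meet_trans v u w :
  (u, v) \in poset_meet -> (v, w) \in poset_meet -> (u, w) \in poset_meet.
Proof.
move=> uv vw; apply/poset_meetP=> i j iu wj.
have {iu}iv := poset_meet_comp iu uv (connect0 _ v).
have {wj}vj := poset_meet_comp (connect0 _ v) vw wj.
case/orP: (poset_meet_weak_pair iv) => [iIv|/and3P[vi ivR ivS]].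
  by move/poset_meetP: vj; apply=> //; apply: connect0.
case/orP: (poset_meet_weak_pair vj) => [vIj|/and3P[jv vjR vjS]].
  by move/poset_meetP: iv; apply=> //; apply: connect0.
have [[_ tR _] [_ tS _]] := (is_posetP R posetR, is_posetP S posetS).
apply/orP; right; apply/and3P; split; first exact: leq_trans jv vi.
  exact: tR ivR vjR.
exact: tS ivS vjS.
Qed.

Lemma poset_meet_inc u v : u <= v -> (u, v) \in poset_meet -> inc_closure u v.
Proof.
move=> uv /poset_meet_weak_pair/orP[//|/and3P[vu _ _]].
by have -> : u = v; [apply/val_inj/eqP; rewrite eqn_leq uv | apply: connect0].
Qed.

Lemma poset_meet_dec u v :
  v <= u -> (u, v) \in poset_meet -> (u, v) \in R /\ (u, v) \in S.
Proof.
have [[rR _ _] [rS _ _]] := (is_posetP R posetR, is_posetP S posetS).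
(* An increasing pair with [v <= u] is diagonal, so reflexivity of [R] and [S] covers it. *)
move=> vu /poset_meet_weak_pair/orP[/inc_closure_leq uv|/and3P[]//].
by have -> : u = v by apply/val_inj/eqP; rewrite eqn_leq uv.
Qed.

(** Along an increasing path from [u] to [v], the pair from [v] back to [u] reverses each step: the
    reversed step is decreasing, hence in both [R] and [S]. Antisymmetry of whichever of them
    contains the step then collapses it. *)
Lemma poset_meet_anti u v :
  (u, v) \in poset_meet -> (v, u) \in poset_meet -> u = v.
Proof.
have [[_ _ sR] [_ _ sS]] := (is_posetP R posetR, is_posetP S posetS).
wlog uv : u v / u <= v => [hw|] uvM vuM.
  by case/orP: (leq_total u v) => [/hw|/hw h]; [|apply/esym]; auto.
move: (poset_meet_inc uv uvM) vuM; move: (u); apply: connect_ind_left => //.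
move=> {uv uvM} {}u k /andP[uk ukRS] kv IH vuM.
have kuM := poset_meet_comp kv vuM (connect0 _ u).
have [kuR kuS] := poset_meet_dec uk kuM.
have eku : u = k by case/orP: ukRS => ?; [apply: sR | apply: sS].
by rewrite eku in vuM *; apply: IH.
Qed.

Lemma poset_meet_poset : is_poset poset_meet.
Proof.
apply/is_posetP; split; last exact: poset_meet_anti.
  by move=> a; apply/inc_closure_poset_meet/connect0.
exact: poset_meet_trans.
Qed.

Lemma poset_meet_lel : weak_order poset_meet R.
Proof.
apply/weak_orderP; split=> a b ab.
  move=> abR; apply/inc_closure_poset_meet/connect1.
  by rewrite /inc_step ab abR.
by case/poset_meet_dec.
Qed.

Lemma poset_meet_ler : weak_order poset_meet S.
Proof.
apply/weak_orderP; split=> a b ab.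
  move=> abS; apply/inc_closure_poset_meet/connect1.
  by rewrite /inc_step ab abS orbT.
by case/poset_meet_dec.
Qed.

(** * The meet dominates every lower bound *)

Section LowerBound.

Variable Z : relation_on n.
Hypotheses (posetZ : is_poset Z).
Hypotheses (leZR : weak_order Z R) (leZS : weak_order Z S).

Lemma inc_closure_lower_bound a b : inc_closure a b -> (a, b) \in Z.
Proof.
have [rZ tZ _] := is_posetP Z posetZ.
have [[Ri _] [Si _]] := (weak_orderP Z R leZR, weak_orderP Z S leZS).
move: a; apply: connect_ind_left => // a c /andP[ac acRS] _.
by apply: tZ; case/orP: acRS; auto.
Qed.

(** The path from [i] to [b] is followed until a step passes [a]; that step can be redirected to end
    at [a]. *)
Lemma lower_bound_inc_left a b i :
  (b, a) \in Z -> inc_closure i b -> i <= a -> a <= b -> inc_closure i a.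
Proof.
have [_ tZ _] := is_posetP Z posetZ.
have [[_ tR _] [_ tS _]] := (is_posetP R posetR, is_posetP S posetS).
have [[_ Rd] [_ Sd]] := (weak_orderP Z R leZR, weak_orderP Z S leZS).
move=> ba ib + ab; move: i ib; apply: connect_ind_left => [lba|i k].
  have -> : a = b by apply/val_inj/eqP; rewrite eqn_leq ab.
  exact: connect0.
move=> ik kb IH ia; case/orP: (leq_total k a) => [ka|ak].
  by apply: connect_trans (connect1 ik) (IH ka).
(* Here [i <= a <= k]. The pair [(k, a)] is decreasing in [Z], hence lies in [R] and in [S], and
   composes with the step from [i] to [k] in whichever of them contains it. *)
have ka : (k, a) \in Z by apply: tZ ba; apply: inc_closure_lower_bound.
apply: connect1; rewrite /inc_step ia /=.
case/andP: ik => _ /orP[ik|ik]; apply/orP.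
  by left; apply: (tR k); auto.
by right; apply: (tS k); auto.
Qed.

(** Mirror argument: the path from [a] is read from its end [j], and the step that passes [b] is
    redirected to start at [b]. *)
Lemma lower_bound_inc_right a b j :
  (b, a) \in Z -> inc_closure a j -> b <= j -> a <= b -> inc_closure b j.
Proof.
have [_ tZ _] := is_posetP Z posetZ.
have [[_ tR _] [_ tS _]] := (is_posetP R posetR, is_posetP S posetS).
have [[_ Rd] [_ Sd]] := (weak_orderP Z R leZR, weak_orderP Z S leZS).
move=> ba aj + ab; move: j aj; apply: connect_ind_right => [lba|k j].
  have -> : a = b by apply/val_inj/eqP; rewrite eqn_leq ab.
  exact: connect0.
move=> ak kj IH bj; case/orP: (leq_total b k) => [bk|kb].
  by apply: connect_trans (IH bk) (connect1 kj).
have bk : (b, k) \in Z by apply: (tZ _ _ _ ba); apply: inc_closure_lower_bound.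
apply: connect1; rewrite /inc_step bj /=.
case/andP: kj => _ /orP[kj|kj]; apply/orP.
  by left; apply: (tR k); auto.
by right; apply: (tS k); auto.
Qed.

Lemma poset_meet_glb : weak_order Z poset_meet.
Proof.
have [_ tZ _] := is_posetP Z posetZ.
have [[_ Rd] [_ Sd]] := (weak_orderP Z R leZR, weak_orderP Z S leZS).
apply/weak_orderP; split=> [a b ab abM | b a ab baZ].
  exact/inc_closure_lower_bound/poset_meet_inc.
apply/poset_meetP=> i j ib aj.
have iaZ : (i, a) \in Z by apply: tZ baZ; apply: inc_closure_lower_bound.
have ijZ : (i, j) \in Z by apply: tZ iaZ _; apply: inc_closure_lower_bound.
(* If [j <= i], then [(i, j)] is a decreasing pair of [Z], hence of [R] and [S]. If [i <= j], an
   increasing path is needed: through [a] when [i <= a], and otherwise from the decreasing pair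
   [(i, a)] of [Z], with [i] in the role of [b]. *)
case/orP: (leq_total i j) => [ij|ji]; last first.
  by apply/orP; right; apply/and3P; split; auto.
apply/orP; left; case/orP: (leq_total i a) => [ia|ai].
  exact: connect_trans (lower_bound_inc_left baZ ib ia ab) aj.
exact: lower_bound_inc_right iaZ aj ij ai.
Qed.

End LowerBound.

End Meet.

Lemma poset_weak_order_meet (x y : poset_on n) :
  exists m, is_meet (@poset_weak_order n) x y m.
Proof.
case: x y => [R pR] [S pS]; exists (Sub _ (poset_meet_poset pR pS)); split.
- exact: poset_meet_lel.
- exact: poset_meet_ler.
- by case=> Z pZ; apply: poset_meet_glb.
Qed.

(** * Joins, by transposition *)

Definition transpose R : relation_on n := [set p | (p.2, p.1) \in R].

Lemma transposeK : involutive transpose.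
Proof. by move=> R; apply/setP=> -[a b]; rewrite !inE. Qed.

(** Transposition exchanges increasing and decreasing pairs, so the two inclusions that define the
    weak order trade places. *)
Lemma transpose_weak_order R S :
  weak_order (transpose S) (transpose R) = weak_order R S.
Proof.
apply/weak_orderP/weak_orderP=> -[hi hd]; split=> a b ab.
- by move: (hd b a ab); rewrite !inE.
- by move: (hi b a ab); rewrite !inE.
- by rewrite !inE; apply: hd.
- by rewrite !inE; apply: hi.
Qed.

Lemma transpose_poset R : is_poset R -> is_poset (transpose R).
Proof.
case/is_posetP=> rR tR sR; apply/is_posetP.
split=> [a|b a c|a b]; rewrite !inE //=.
  by move=> ba cb; apply: tR cb ba.
by move=> ba ab; apply: sR.
Qed.

Definition poset_dual (x : poset_on n) : poset_on n :=
  Sub (transpose (val x)) (transpose_poset (valP x)).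

Lemma poset_dualK : involutive poset_dual.
Proof. by move=> x; apply: val_inj; rewrite /= transposeK. Qed.

Lemma poset_dual_weak_order x y :
  poset_weak_order (poset_dual y) (poset_dual x) = poset_weak_order x y.
Proof. exact: transpose_weak_order. Qed.

Lemma poset_weak_order_join (x y : poset_on n) :
  exists z, is_join (@poset_weak_order n) x y z.
Proof.
have [m [mx my glb]] := poset_weak_order_meet (poset_dual x) (poset_dual y).
exists (poset_dual m); split.
- by rewrite -poset_dual_weak_order poset_dualK.
- by rewrite -poset_dual_weak_order poset_dualK.
move=> z xz yz; rewrite -poset_dual_weak_order poset_dualK.
by apply: glb; rewrite poset_dual_weak_order.
Qed.

End Posets.

Theorem theorem1 (n : nat) : is_lattice (@poset_weak_order n).
Proof.
split.
- by move=> x; apply: weak_order_refl.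
- by move=> x y /weak_order_anti/val_inj.
- by move=> y x z; apply: weak_order_trans.
- exact: poset_weak_order_meet.
- exact: poset_weak_order_join.
Qed.
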